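(* The algebra $\mathcal{H}^{\mathrm{dif}}=\mathbb{C}\langle a_1,a_2,\dots\rangle$, endowed with the co-product $\Delta^{\mathrm{dif}}$ and the co-unit $\varepsilon$, is a graded and connected Hopf algebra, which is neither commutative nor co-commutative.
   Context: $\mathcal{H}^{\mathrm{dif}}=\mathbb{C}\langle a_1,a_2,\dots\rangle$ is the free associative unital $\mathbb{C}$-algebra on infinitely many variables $a_n$, $n\ge 1$; put $a_0:=1$. Let $A(x)=\sum_{n\ge 0}a_n x^{n+1}$ be the generating series, where $x$ (like all power series variables) commutes with everything. The co-product $\Delta^{\mathrm{dif}}:\mathcal{H}^{\mathrm{dif}}\to\mathcal{H}^{\mathrm{dif}}\otimes\mathcal{H}^{\mathrm{dif}}$ is the unital algebra homomorphism defined on generators by $$\Delta^{\mathrm{dif}}A(x):=\sum_{n\ge0}\Delta^{\mathrm{dif}}(a_n)x^{n+1}=\langle z^{-1}\rangle\, A(z)\otimes\frac{1}{z-A(x)},$$ where $\frac1{z-A(x)}$ is expanded as $\sum_{k\ge0}A(x)^k z^{-k-1}$ and $\langle z^{-1}\rangle F(z)$ denotes the coefficient of $z^{-1}$ in $F(z)$. The co-unit $\varepsilon:\mathcal{H}^{\mathrm{dif}}\to\mathbb{C}$ is the algebra homomorphism with $\varepsilon(1)=1$ and $\varepsilon(a_n)=0$ for $n\ge1$. The grading is given by letting the monomial $a_{j_1}a_{j_2}\cdots a_{j_m}$ have degree $j_1+j_2+\dots+j_m$. Connected means that the degree zero part consists only of the scalars. *)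

(* Defs.v *)
From HB Require Import structures.
From mathcomp Require Import all_boot all_order all_algebra.
From mathcomp Require Import finmap monalg complex.
From mathcomp Require Import classical_sets fsbigop reals.

Set Implicit Arguments.
Unset Strict Implicit.
Unset Printing Implicit Defensive.

Import GRing.Theory.
Local Open Scope ring_scope.

(* The product monoid, so that {malg K[M * N]} is a ring. *)
Section ProdMonom.
Variables M N : monomType.

Definition pmone : M * N := (mone, mone).
Definition pmmul (p q : M * N) : M * N := (mmul p.1 q.1, mmul p.2 q.2).

Fact pmmulA : associative pmmul.
Proof. by move=> p q r; rewrite /pmmul /= !mulmA. Qed.

Fact pmmul1m : left_id pmone pmmul.
Proof. by case=> m n; rewrite /pmmul /= !mul1m. Qed.

Fact pmmulm1 : right_id pmone pmmul.
Proof. by case=> m n; rewrite /pmmul /= !mulm1. Qed.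

Fact pmmul_eq1 p q : pmmul p q = pmone -> p = pmone /\ q = pmone.
Proof.
by case: p q => [m n] [m' n'] [] /= /unitm[-> ->] /unitm[-> ->].
Qed.

HB.instance Definition _ := Choice_isMonomialDef.Build (M * N)%type
  pmmulA pmmul1m pmmulm1 pmmul_eq1.
End ProdMonom.

(* The tensor product of {malg K[M]} and {malg K[N]}, which have bases M and  *)
(* N, is {malg K[M * N]}, with basis M * N.  Lemmas tens_bilinear,            *)
(* tlift_linear, tliftE and tlift_uniq are its universal property; tensM says *)
(* that its ring structure is that of a tensor product of algebras.           *)
Notation tensor K M N := {malg K[(M * N)%type]}.

Definition is_bilinear (K : fieldType) (U V W : lmodType K)
    (b : U -> V -> W) : Prop :=
  (forall v, linear (fun u => b u v)) /\ (forall u, linear (b u)).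

Section Tensor.
Variables (K : fieldType) (M N : monomType).

Definition tens (x : {malg K[M]}) (y : {malg K[N]}) : tensor K M N :=
  \sum_(m <- msupp x) \sum_(n <- msupp y) << x@_m * y@_n *g (m, n) >>.

(* The linear map on the tensor product induced by a bilinear map b. *)
Definition tlift (W : lmodType K) (b : {malg K[M]} -> {malg K[N]} -> W)
    (t : tensor K M N) : W :=
  \sum_(p <- msupp t) t@_p *: b << p.1 >> << p.2 >>.
End Tensor.

Notation "x \ot y" := (tens x y) (at level 40, left associativity).

Section TensorMaps.
Variable K : fieldType.

Definition tmap (M N M' N' : monomType) (f : {malg K[M]} -> {malg K[M']})
    (g : {malg K[N]} -> {malg K[N']}) : tensor K M N -> tensor K M' N' :=
  tlift (fun x y => f x \ot g y).

Definition tflip (M N : monomType) : tensor K M N -> tensor K N M :=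
  tlift (fun x y => y \ot x).

Definition tassoc (M N P : monomType) :
    tensor K (M * N)%type P -> tensor K M (N * P)%type :=
  tlift (fun t z => tlift (fun x y => x \ot (y \ot z)) t).

Definition tmul (M : monomType) : tensor K M M -> {malg K[M]} :=
  tlift (fun x y => x * y).
End TensorMaps.

Section TensorTheory.
Variables (K : fieldType) (M N : monomType).
Implicit Types (x : {malg K[M]}) (y : {malg K[N]}) (t : tensor K M N).

Lemma tensE x y m n : (x \ot y)@_(m, n) = x@_m * y@_n.
Proof.
rewrite /tens raddf_sum /=.
under eq_bigr => i _.
  rewrite raddf_sum /=.
  under eq_bigr => j _ do rewrite mcoeffU xpair_eqE.
  over.
have [mx|mx] := msuppP x m; last first.
  rewrite mul0r big_seq big1 // => i ix; rewrite big1 // => j _.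
  by case: eqP ix mx => [->->|].
have [ny|ny] := msuppP y n; last first.
  rewrite mulr0 big1 // => i _; rewrite big_seq big1 // => j jy.
  by case: (j =P n) jy ny => [->->|]; rewrite ?andbF.
rewrite (big_fsetD1 m) //= (big_fsetD1 n) //= !eqxx.
rewrite big_seq big1 ?addr0 => [|j]; last first.
  by rewrite in_fsetD1 => /andP[/negbTE->].
rewrite big_seq big1 ?addr0 // => i.
rewrite in_fsetD1 => /andP[/negbTE-> _].
by rewrite big1.
Qed.

Lemma tens_bilinear : is_bilinear (@tens K M N).
Proof.
split=> [y c x x'|x c y y']; apply/malgP=> -[m n].
  by rewrite mcoeffD mcoeffZ !tensE mcoeffD mcoeffZ mulrDl mulrA.
by rewrite mcoeffD mcoeffZ !tensE mcoeffD mcoeffZ mulrDr mulrCA.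
Qed.

Lemma tensUU m n :
  (<< m >> : {malg K[M]}) \ot (<< n >> : {malg K[N]}) = << (m, n) >>.
Proof.
apply/malgP=> -[i j]; rewrite tensE !mcoeffU1 xpair_eqE.
by rewrite -natrM mulnb.
Qed.

Lemma tens0l y : 0 \ot y = 0 :> tensor K M N.
Proof. by rewrite /tens msupp0 big_seq_fset0. Qed.

Lemma tens0r x : x \ot 0 = 0 :> tensor K M N.
Proof. by rewrite /tens big1 // => m _; rewrite msupp0 big_seq_fset0. Qed.

Variable W : lmodType K.
Implicit Type b : {malg K[M]} -> {malg K[N]} -> W.

Lemma tliftEw b (d : {fset (M * N)%type}) t : (msupp t `<=` d)%fset ->
  tlift b t = \sum_(p <- d) t@_p *: b << p.1 >> << p.2 >>.
Proof.
move=> le; rewrite [LHS](big_fset_incl _ le) => //= p _ /mcoeff_outdom ->.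
by rewrite scale0r.
Qed.

Lemma tlift_linear b : linear (tlift b).
Proof.
move=> c t t'; pose d := (msupp t `|` msupp t')%fset.
have le1 : (msupp t `<=` d)%fset by apply: fsubsetUl.
have le2 : (msupp t' `<=` d)%fset by apply: fsubsetUr.
have le : (msupp (c *: t + t') `<=` d)%fset.
  by apply: fsubset_trans (msuppD_le _ _) (fsetSU _ (msuppZ_le _ _)).
rewrite (tliftEw _ le1) (tliftEw _ le2) (tliftEw _ le) scaler_sumr -big_split.
by apply: eq_bigr => p _; rewrite mcoeffD mcoeffZ scalerDl scalerA.
Qed.

Lemma tliftU b m n : tlift b << (m, n) >> = b << m >> << n >>.
Proof. by rewrite (tliftEw _ msuppU_le) big_seq_fset1 mcoeffUU scale1r. Qed.

Lemma malg_lin (L : monomType) (f : {malg K[L]} -> W) (x : {malg K[L]}) :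
  linear f -> f x = \sum_(m <- msupp x) x@_m *: f << m >>.
Proof.
move=> lf; pose mf := GRing.isLinear.Build K {malg K[L]} W _ f lf.
pose F : {linear {malg K[L]} -> W} := HB.pack f mf.
rewrite -[f]/(F : _ -> _) {1}[x]monalgE raddf_sum; apply: eq_bigr => m _.
rewrite -linearZ /=; congr f; apply/malgP => l.
by rewrite mcoeffZ !mcoeffU mulrnAr mulr1.
Qed.

Lemma tlift_uniq b (f : tensor K M N -> W) :
  linear f -> (forall x y, f (x \ot y) = b x y) -> f =1 tlift b.
Proof.
move=> lf fb t; rewrite (malg_lin t lf); apply: eq_bigr => -[m n] _ /=.
by rewrite -fb tensUU.
Qed.

Lemma tliftE b x y : is_bilinear b -> tlift b (x \ot y) = b x y.
Proof.
case=> bl br; rewrite (malg_lin x (bl y)).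
rewrite (malg_lin (f := fun x => tlift b (x \ot y)) x); last first.
  by move=> c u v; rewrite (tens_bilinear.1 y) tlift_linear.
apply: eq_bigr => m _; congr (_ *: _); rewrite (malg_lin y (br _)).
rewrite (malg_lin (f := fun y => tlift b (<< m >> \ot y)) y); last first.
  by move=> c u v; rewrite (tens_bilinear.2 _) tlift_linear.
by apply: eq_bigr => n _; rewrite tensUU tliftU.
Qed.
End TensorTheory.

Lemma malg_scaleAr (K : fieldType) (M : monomType) (c : K) (x y : {malg K[M]}) :
  c *: (x * y) = x * (c *: y).
Proof.
apply/malgP => m; rewrite mcoeffZ.
rewrite (mcoeffMlw _ (fsubset_refl (msupp x)) (fsubset_refl (msupp y))).
rewrite (mcoeffMlw _ (fsubset_refl (msupp x)) (msuppZ_le c y)).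
rewrite mulr_sumr; apply: eq_bigr => i _; rewrite mulr_sumr.
by apply: eq_bigr => j _; rewrite mcoeffZ mulrnAr mulrCA.
Qed.

Lemma tensM (K : fieldType) (M N : monomType)
    (x x' : {malg K[M]}) (y y' : {malg K[N]}) :
  (x \ot y) * (x' \ot y') = (x * x') \ot (y * y').
Proof.
rewrite (malg_lin x (f := fun x => (x \ot y) * (x' \ot y'))); last first.
  by move=> c u v; rewrite (@tens_bilinear _ _ _).1 mulrDl scalerAl.
rewrite (malg_lin x (f := fun x => (x * x') \ot (y * y'))); last first.
  by move=> c u v; rewrite mulrDl -scalerAl (@tens_bilinear _ _ _).1.
apply: eq_bigr => m _; congr (_ *: _).
rewrite (malg_lin y (f := fun y => (_ \ot y) * (x' \ot y'))); last first.
  by move=> c u v; rewrite (@tens_bilinear _ _ _).2 mulrDl scalerAl.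
rewrite (malg_lin y (f := fun y => _ \ot (y * y'))); last first.
  by move=> c u v; rewrite mulrDl -scalerAl (@tens_bilinear _ _ _).2.
apply: eq_bigr => n _; congr (_ *: _).
rewrite (malg_lin x' (f := fun x' => (_ \ot _) * (x' \ot y'))); last first.
  by move=> c u v; rewrite (@tens_bilinear _ _ _).1 mulrDr malg_scaleAr.
rewrite (malg_lin x' (f := fun x' => (_ * x') \ot _)); last first.
  by move=> c u v; rewrite mulrDr -malg_scaleAr (@tens_bilinear _ _ _).1.
apply: eq_bigr => m' _; congr (_ *: _).
rewrite (malg_lin y' (f := fun y' => (_ \ot _) * (_ \ot y'))); last first.
  by move=> c u v; rewrite (@tens_bilinear _ _ _).2 mulrDr malg_scaleAr.
rewrite (malg_lin y' (f := fun y' => _ \ot (_ * y'))); last first.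
  by move=> c u v; rewrite mulrDr -malg_scaleAr (@tens_bilinear _ _ _).2.
apply: eq_bigr => n' _; congr (_ *: _).
by rewrite !tensUU !malgM_def !fgmulUU !mulr1 tensUU.
Qed.

Section Hopf.
Variables (K : fieldType) (M : monomType).
Local Notation H := {malg K[M]}.
Local Notation HH := (tensor K M M).

Record is_bialgebra (Delta : H -> HH) (eps : H -> K) : Prop := {
  comult_linear : linear Delta;
  comult1 : Delta 1 = 1;
  comultM : {morph Delta : x y / x * y};
  counit_linear : scalar eps;
  counit1 : eps 1 = 1;
  counitM : {morph eps : x y / x * y};
  coassoc : forall x,
    tassoc (tmap Delta id (Delta x)) = tmap id Delta (Delta x);
  counitl : forall x, tlift (fun y z => eps y *: z) (Delta x) = x;
  counitr : forall x, tlift (fun y z => eps z *: y) (Delta x) = x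
}.

Record is_antipode (Delta : H -> HH) (eps : H -> K) (S : H -> H) : Prop := {
  antipode_linear : linear S;
  antipodel : forall x, tmul (tmap S id (Delta x)) = (eps x)%:A;
  antipoder : forall x, tmul (tmap id S (Delta x)) = (eps x)%:A
}.

Definition is_hopf_algebra (Delta : H -> HH) (eps : H -> K) (S : H -> H) :=
  is_bialgebra Delta eps /\ is_antipode Delta eps S.

Definition cocommutative (Delta : H -> HH) : Prop :=
  forall x, tflip (Delta x) = Delta x.
End Hopf.

(* V is the direct sum of its subspaces Vn 0, Vn 1, ... *)
Record is_grading (K : fieldType) (V : lmodType K) (Vn : nat -> V -> Prop) :
    Prop := {
  grading0 : forall n, Vn n 0;
  gradingP : forall n (c : K) x y, Vn n x -> Vn n y -> Vn n (c *: x + y);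
  grading_span : forall x, exists (N : nat) (c : nat -> V),
    (forall n, Vn n (c n)) /\ x = \sum_(n < N) c n;
  grading_free : forall (N : nat) (c : nat -> V), (forall n, Vn n (c n)) ->
    \sum_(n < N) c n = 0 -> forall n, (n < N)%N -> c n = 0
}.

(* The degree n part of a tensor product: the span of the x \ot y with x and  *)
(* y homogeneous of degrees adding up to n.                                   *)
Definition tens_grading (K : fieldType) (M N : monomType)
    (Vn : nat -> {malg K[M]} -> Prop) (Wn : nat -> {malg K[N]} -> Prop)
    (n : nat) (t : tensor K M N) : Prop :=
  exists (r : nat) (x : 'I_r -> {malg K[M]}) (y : 'I_r -> {malg K[N]}),
    (forall k, exists i j, [/\ (i + j = n)%N, Vn i (x k) & Wn j (y k)]) /\
    t = \sum_k x k \ot y k.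

Record is_graded_hopf_algebra (K : fieldType) (M : monomType)
    (Delta : {malg K[M]} -> tensor K M M) (eps : {malg K[M]} -> K)
    (S : {malg K[M]} -> {malg K[M]}) (Hn : nat -> {malg K[M]} -> Prop) :
    Prop := {
  graded_hopf : is_hopf_algebra Delta eps S;
  graded_sum : is_grading Hn;
  graded1 : Hn 0%N 1;
  gradedM : forall i j x y, Hn i x -> Hn j y -> Hn (i + j)%N (x * y);
  graded_comult : forall n x, Hn n x -> tens_grading Hn Hn n (Delta x);
  graded_counit : forall n x, (0 < n)%N -> Hn n x -> eps x = 0;
  graded_antipode : forall n x, Hn n x -> Hn n (S x)
}.

Definition is_connected (K : fieldType) (M : monomType)
    (Hn : nat -> {malg K[M]} -> Prop) : Prop :=
  forall x, Hn 0%N x <-> exists c : K, x = c%:A.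

Section Series.
Variable A : nzRingType.

(* f : nat -> A stands for the power series \sum_n f n x^n, x central. *)
Definition series_mul (f g : nat -> A) : nat -> A :=
  fun n => \sum_(i < n.+1) f i * g (n - i)%N.

Definition series_exp (f : nat -> A) (k : nat) : nat -> A :=
  iter k (series_mul f) (fun n => (n == 0%N)%:R).

(* Coefficient of z^j x^n in 1 / (z - f(x)) = \sum_k f(x)^k z^(-k-1); recall  *)
(* that Negz k is - k - 1.                                                    *)
Definition resolvent (f : nat -> A) (j : int) (n : nat) : A :=
  if j is Negz k then series_exp f k n else 0.
End Series.

Lemma series_exp_small (A : nzRingType) (f : nat -> A) (k n : nat) :
  f 0%N = 0 -> (n < k)%N -> series_exp f k n = 0.
Proof.
move=> f0; elim: k n => [//|k IH] n nk; rewrite /series_exp /= /series_mul.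
rewrite big1 // => -[[|i] /= ilt] _; first by rewrite f0 mul0r.
rewrite [iter _ _ _ _]IH ?mulr0 //.
by case: n nk ilt => // n nk ilt; rewrite subSS (leq_ltn_trans (leq_subr _ _)).
Qed.

Section Dif.
Variable K : fieldType.

(* The letter i : nat of the free monoid stands for the variable a_(i+1). *)
Local Notation Hdif := {malg K[{fmonom nat}]}.
Local Notation HHdif := (tensor K {fmonom nat} {fmonom nat}).

Definition dif_a (n : nat) : Hdif := if n is i.+1 then << fmu i >> else 1.

(* A(x) = \sum_n a_n x^(n+1) *)
Definition dif_series (n : nat) : Hdif := if n is m.+1 then dif_a m else 0.

(* Coefficient of z^j x^n in A(z) \ot 1 / (z - A(x)).  The sum runs over a    *)
(* finite support: as A(x) has no constant term, resolvent dif_series (j - i) *)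
(* n vanishes as soon as i > j + n + 1.                                       *)
Definition dif_kernel (j : int) (n : nat) : HHdif :=
  \sum_(i \in [set: nat]) dif_series i \ot resolvent dif_series (j - i%:Z) n.

(* For B with central scalars, the algebra morphism a_(i+1) |-> g i.+1; see   *)
(* free_ext_a and free_ext_uniq.                                              *)
Definition free_ext (B : lalgType K) (g : nat -> B) (x : Hdif) : B :=
  \sum_(w <- msupp x) x@_w *: \prod_(i <- (w : seq nat)) g i.+1.

(* The coefficient of z^-1 x^(n+1). *)
Definition dif_comult_a (n : nat) : HHdif := dif_kernel (-1) n.+1.

Definition dif_comult : Hdif -> HHdif := free_ext dif_comult_a.

Definition dif_counit : Hdif -> K := free_ext (fun _ => 0 : K^o).

Definition dif_degree (w : {fmonom nat}) : nat :=
  (\sum_(i <- (w : seq nat)) i.+1)%N.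

Definition dif_homog (n : nat) (x : Hdif) : Prop :=
  forall w, w \in msupp x -> dif_degree w = n.

Lemma free_ext_a (B : lalgType K) (g : nat -> B) (i : nat) :
  free_ext g (dif_a i.+1) = g i.+1.
Proof.
by rewrite /free_ext /= msuppU1 big_seq_fset1 mcoeffUU scale1r fmU big_seq1.
Qed.

Lemma free_ext_uniq (B : lalgType K) (g : nat -> B) (f : Hdif -> B) :
  linear f -> f 1 = 1 -> {morph f : x y / x * y} ->
  (forall i, f (dif_a i.+1) = g i.+1) -> f =1 free_ext g.
Proof.
move=> lf f1 fM fa x; rewrite (malg_lin x lf); apply: eq_bigr => w _.
congr (_ *: _); case: w => s; elim: s => [|i s IH].
  by rewrite big_nil -f1; congr (f << _ >>); apply/eqP; rewrite fmP fm1.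
rewrite big_cons -IH -fa -fM /= malgM_def fgmulUU mulr1.
by congr (f << _ >>); apply/eqP; rewrite fmP fmM fmU.
Qed.

Lemma dif_kernelE (n : nat) :
  dif_kernel (-1) n =
    \sum_(i < n.+1) dif_series i \ot series_exp dif_series i n.
Proof.
pose F i : HHdif := dif_series i \ot series_exp dif_series i n.
rewrite -(big_mkord predT F) big_mkcond /dif_kernel.
rewrite (fsbigTE [fset k | k in iota 0 n.+1]%fset) => [|i]; last first.
  rewrite in_fset mem_iota leq0n add0n -leqNgt => ni.
  have -> : -1 - i%:Z = Negz i by rewrite NegzE -addn1 PoszD opprD addrC.
  by rewrite /= series_exp_small ?tens0r.
rewrite (perm_big (iota 0 n.+1)); last first.
  by apply: uniq_perm (fset_uniq _) (iota_uniq 0 n.+1) _ => i; rewrite in_fset.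
rewrite /index_iota subn0; apply: eq_bigr => i _.
by have -> : -1 - i%:Z = Negz i by rewrite NegzE -addn1 PoszD opprD addrC.
Qed.

Lemma dif_comult_series (n : nat) :
  dif_comult (dif_series n) = dif_kernel (-1) n.
Proof.
case: n => [|[|n]]; last exact: free_ext_a.
  rewrite /dif_comult /free_ext msupp0 big_seq_fset0 dif_kernelE big_ord1.
  by rewrite tens0l.
rewrite /dif_comult /free_ext msuppU1 big_seq_fset1 mcoeffUU scale1r fm1 big_nil.
have e1 : series_exp dif_series 1 1 = 1.
  rewrite [LHS]big_ord_recl big_ord1 [X in X + _]mul0r add0r.
  exact: mulr1.
rewrite dif_kernelE big_ord_recl big_ord1 [series_exp _ (lift _ _) _]e1.
by rewrite [dif_series _ \ot _]tens0l add0r; exact: esym (tensUU _ _ _).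
Qed.
End Dif.

(* Main.v *)
Require Import Defs.
From mathcomp Require Import all_boot all_order all_algebra.
From mathcomp Require Import finmap monalg complex.
From mathcomp Require Import reals.

(** Write A(x) = sum_n A_n x^n, so that A_0 = 0, A_1 = 1 and A_(n+1) = a_n, and
    let M be the infinite matrix whose entry M_jn is the coefficient of x^n in
    A(x)^j.  It is upper unitriangular, and its row 1 is A(x).  Extracting the
    coefficient of z^-1 gives Delta A_n = sum_i A_i (x) M_in.

    Everything follows from the fact that M is group-like
    (dif_comult_mx, dif_counit_mx): Delta M_jn = sum_i M_ji (x) M_in and
    eps M_jn = delta_jn.  Although the algebra is not commutative, the powers of
    the single series A(x) still satisfy A^k A^l = A^(k+l), and this is all that
    the induction on j uses.  Since Delta and eps are algebra morphisms, the
    bialgebra axioms need only be checked on the A_n, where co-associativity is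
    the associativity of the matrix product and the co-unit axioms say that the
    identity matrix is neutral.

    The antipode S is the anti-morphism whose values u_n = S(A_n) solve the
    triangular system sum_i u_i M_in = delta_1n (unitriangular_solve).  This is
    the left antipode identity on generators.  Both antipode identities are
    stable under products because S reverses them (tmul_tmaplM, tmul_tmaprM), so
    the left one holds everywhere; applied to the entries of M, it says that the
    matrix S(M) is a left inverse of M.  A left inverse of a unitriangular
    matrix that is itself unitriangular is also a right inverse, even over a
    non-commutative ring (unitriangular_linv_rinv), and row 1 of M S(M) = 1 is
    the right antipode identity on generators.

    The entry M_jn is homogeneous of degree n - j (dif_mx_degree), which makes
    Delta and S homogeneous.  Only the empty word has degree 0, whence
    connectedness.  Finally a_1 and a_2 do not commute, and the co-product of
    a_3 contains a_1 (x) a_1 a_1 but not a_1 a_1 (x) a_1. *)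

Set Implicit Arguments.
Unset Strict Implicit.
Unset Printing Implicit Defensive.

Import GRing.Theory.

Local Open Scope ring_scope.

(** * Linear maps on monoid algebras and tensor products *)

Section LinearMaps.
Variable K : fieldType.

Section Linear.
Variables (V W : lmodType K) (f : V -> W).
Hypothesis lf : linear f.

Lemma linear_fun0 : f 0 = 0.
Proof.
by have := lf (-1) 0 0; rewrite scaler0 addr0 scaleN1r addNr.
Qed.

Lemma linear_funD x y : f (x + y) = f x + f y.
Proof. by have := lf 1 x y; rewrite !scale1r. Qed.

Lemma linear_funZ c x : f (c *: x) = c *: f x.
Proof. by have := lf c x 0; rewrite linear_fun0 !addr0. Qed.

Lemma linear_fun_sum I (r : seq I) (P : pred I) F :
  f (\sum_(i <- r | P i) F i) = \sum_(i <- r | P i) f (F i).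
Proof. exact: (big_morph f linear_funD linear_fun0). Qed.
End Linear.

Lemma linear_comp (U V W : lmodType K) (f : V -> W) (g : U -> V) :
  linear f -> linear g -> linear (fun x => f (g x)).
Proof. by move=> lf lg c x y; rewrite lg lf. Qed.

Section Basis.
Variable M : monomType.

Lemma malg_ind (P : {malg K[M]} -> Prop) :
    (forall c x y, P x -> P y -> P (c *: x + y)) ->
    (forall m, P << m >>) -> forall x, P x.
Proof.
move=> PD PU x; have P0 : P 0.
  by rewrite -(addNr << mone >>) -scaleN1r; apply: PD.
rewrite (malg_lin (f := id) x) //.
by elim/big_rec: _ => // m y _ Py; apply: PD.
Qed.

Lemma malgUM m n : << mmul m n >> = << m >> * << n >> :> {malg K[M]}.
Proof. by rewrite malgM_def fgmulUU mulr1. Qed.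

(** Stated for a target whose scalars are central: multiplying on the right by
    a scalar multiple has to be linear for the reduction to the basis. *)
Lemma malg_linear_morphM (B : lalgType K) (f : {malg K[M]} -> B) :
    (forall c (x y : B), c *: (x * y) = x * (c *: y)) -> linear f ->
    (forall m n, f << mmul m n >> = f << m >> * f << n >>) ->
  {morph f : x y / x * y}.
Proof.
move=> BZ lf fM x y; elim/malg_ind: x => [c x x' fx fx'|m].
  by rewrite mulrDl -scalerAl !lf mulrDl -scalerAl fx fx'.
elim/malg_ind: y => [c y y' fy fy'|n]; last by rewrite -malgUM fM.
by rewrite mulrDr -malg_scaleAr !lf mulrDr -BZ fy fy'.
Qed.

Lemma malg_linear_antimorphM (f : {malg K[M]} -> {malg K[M]}) :
    linear f -> (forall m n, f << mmul m n >> = f << n >> * f << m >>) ->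
  forall x y, f (x * y) = f y * f x.
Proof.
move=> lf fM x y; elim/malg_ind: x => [c x x' fx fx'|m].
  by rewrite mulrDl -scalerAl !lf mulrDr -malg_scaleAr fx fx'.
elim/malg_ind: y => [c y y' fy fy'|n]; last by rewrite -malgUM fM.
by rewrite mulrDr -malg_scaleAr !lf mulrDl -scalerAl fy fy'.
Qed.

Definition basis_ext (W : lmodType K) (F : M -> W) (x : {malg K[M]}) : W :=
  \sum_(m <- msupp x) x@_m *: F m.

Lemma basis_extEw (W : lmodType K) (F : M -> W) (d : {fset M}) x :
  (msupp x `<=` d)%fset -> basis_ext F x = \sum_(m <- d) x@_m *: F m.
Proof.
move=> le; rewrite [LHS](big_fset_incl _ le) => //= p _ /mcoeff_outdom ->.
by rewrite scale0r.
Qed.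

Lemma basis_extU (W : lmodType K) (F : M -> W) m : basis_ext F << m >> = F m.
Proof. by rewrite (basis_extEw _ msuppU_le) big_seq_fset1 mcoeffUU scale1r. Qed.

Lemma basis_ext_linear (W : lmodType K) (F : M -> W) : linear (basis_ext F).
Proof.
move=> c x y; pose d := (msupp x `|` msupp y)%fset.
have lex : (msupp x `<=` d)%fset by apply: fsubsetUl.
have ley : (msupp y `<=` d)%fset by apply: fsubsetUr.
have le : (msupp (c *: x + y) `<=` d)%fset.
  by apply: fsubset_trans (msuppD_le _ _) (fsetSU _ (msuppZ_le _ _)).
rewrite (basis_extEw _ lex) (basis_extEw _ ley) (basis_extEw _ le).
rewrite scaler_sumr -big_split.
by apply: eq_bigr => p _; rewrite mcoeffD mcoeffZ scalerDl scalerA.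
Qed.
End Basis.

Section Tensors.
Variables M N : monomType.

Lemma tens11 : 1 \ot 1 = 1 :> tensor K M N.
Proof. exact: tensUU. Qed.

Lemma tens_suml I (r : seq I) (P : pred I) (F : I -> {malg K[M]})
    (y : {malg K[N]}) :
  (\sum_(i <- r | P i) F i) \ot y = \sum_(i <- r | P i) F i \ot y.
Proof. exact: (linear_fun_sum (proj1 (tens_bilinear K M N) y)). Qed.

Lemma tens_sumr I (r : seq I) (P : pred I) (x : {malg K[M]})
    (F : I -> {malg K[N]}) :
  x \ot (\sum_(i <- r | P i) F i) = \sum_(i <- r | P i) x \ot F i.
Proof. exact: (linear_fun_sum (proj2 (tens_bilinear K M N) x)). Qed.

Lemma tens_ind (P : tensor K M N -> Prop) :
    (forall c t t', P t -> P t' -> P (c *: t + t')) ->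
    (forall x y, P (x \ot y)) -> forall t, P t.
Proof. by move=> PD Pt; apply: malg_ind => // -[m n]; rewrite -tensUU. Qed.

Lemma tens_linear_morphM (B : lalgType K) (f : tensor K M N -> B) :
    (forall c (x y : B), c *: (x * y) = x * (c *: y)) -> linear f ->
    (forall x x' y y',
       f ((x * x') \ot (y * y')) = f (x \ot y) * f (x' \ot y')) ->
  {morph f : t u / t * u}.
Proof.
move=> BZ lf fM; apply: (malg_linear_morphM BZ lf) => -[m n] [m' n'].
by rewrite -!tensUU -fM -!malgUM tensUU.
Qed.

Lemma tlift_linear_param (U W : lmodType K)
    (b : U -> {malg K[M]} -> {malg K[N]} -> W) :
    (forall x y, linear (fun u => b u x y)) ->
  forall t, linear (fun u => tlift (b u) t).
Proof.
move=> lb t c u v; rewrite /tlift scaler_sumr -big_split.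
apply: eq_bigr => p _.
rewrite (linear_funD (lb _ _)) (linear_funZ (lb _ _)).
by rewrite scalerDr !scalerA mulrC.
Qed.
End Tensors.

Lemma mulr_bilinear (M : monomType) :
  is_bilinear (fun x y : {malg K[M]} => x * y).
Proof.
split=> [y c x x'|x c y y']; first by rewrite mulrDl -scalerAl.
by rewrite mulrDr -malg_scaleAr.
Qed.

Lemma bilinear_comp (U V U' V' W : lmodType K) (b : U' -> V' -> W)
    (f : U -> U') (g : V -> V') :
  is_bilinear b -> linear f -> linear g ->
  is_bilinear (fun x y => b (f x) (g y)).
Proof.
by case=> bl br lf lg; split=> [y|x] c u v; rewrite ?lf ?lg ?bl ?br.
Qed.

Section TensorMapsTheory.
Variables (M N M' N' P : monomType).
Variables (f : {malg K[M]} -> {malg K[M']}) (g : {malg K[N]} -> {malg K[N']}).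
Hypotheses (lf : linear f) (lg : linear g).

Lemma tmap_linear : linear (tmap f g).
Proof. exact: tlift_linear. Qed.

Lemma tmapE x y : tmap f g (x \ot y) = f x \ot g y.
Proof. exact: tliftE (bilinear_comp (tens_bilinear K _ _) lf lg). Qed.

Lemma tmap_morphM : {morph f : x y / x * y} -> {morph g : x y / x * y} ->
  {morph tmap f g : t u / t * u}.
Proof.
move=> fM gM; apply: (tens_linear_morphM _ tmap_linear).
  exact: malg_scaleAr.
by move=> x x' y y'; rewrite !tmapE tensM fM gM.
Qed.

Lemma tflip_linear : linear (@tflip K M N).
Proof. exact: tlift_linear. Qed.

Lemma mcoeff_tflip (t : tensor K M N) m n : (tflip t)@_(n, m) = t@_(m, n).
Proof.
elim/tens_ind: t => [c t t' et et'|x y].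
  by rewrite tflip_linear !mcoeffD !mcoeffZ et et'.
rewrite [tflip _]tliftE; first by rewrite !tensE mulrC.
by have [bl br] := tens_bilinear K N M; split.
Qed.

Lemma tassoc_linear : linear (@tassoc K M N P).
Proof. exact: tlift_linear. Qed.

Lemma tassocE (x : {malg K[M]}) (y : {malg K[N]}) (z : {malg K[P]}) :
  tassoc ((x \ot y) \ot z) = x \ot (y \ot z).
Proof.
rewrite /tassoc tliftE; last first.
  split=> [z' |t]; first exact: tlift_linear.
  by apply: tlift_linear_param => x' y'; apply: linear_comp;
    apply: (proj2 (tens_bilinear K _ _)).
rewrite tliftE //; apply: bilinear_comp (tens_bilinear K _ _) _ _ => //.
exact: (proj1 (tens_bilinear K _ _) z).
Qed.

Lemma tassocU (m : M) (n : N) (p : P) :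
  tassoc << ((m, n), p) >> = << (m, (n, p)) >> :> tensor K M (N * P)%type.
Proof. by rewrite -!tensUU tassocE. Qed.

Lemma tassoc_morphM : {morph @tassoc K M N P : t u / t * u}.
Proof.
apply: (malg_linear_morphM _ tassoc_linear); first exact: malg_scaleAr.
by move=> [[m1 m2] m3] [[n1 n2] n3]; rewrite !tassocU -malgUM.
Qed.
End TensorMapsTheory.

Section TensorContraction.
Variables (M N : monomType) (e : {malg K[M]} -> K).
Hypothesis le : scalar e.

Lemma tlift_scalelE y (z : {malg K[N]}) :
  tlift (fun y z => e y *: z) (y \ot z) = e y *: z.
Proof.
apply: (tliftE (b := fun y (z : {malg K[N]}) => e y *: z)).
split=> [v c u w|u c v w]; first by rewrite le scalerDl scalerA.
by rewrite scalerDr !scalerA mulrC.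
Qed.

Lemma tlift_scalerE (y : {malg K[N]}) z :
  tlift (fun y z => e z *: y) (y \ot z) = e z *: y.
Proof.
apply: (tliftE (b := fun (y : {malg K[N]}) z => e z *: y)).
split=> [v c u w|u c v w]; last by rewrite le scalerDl scalerA.
by rewrite scalerDr !scalerA mulrC.
Qed.

Hypothesis eM : {morph e : x y / x * y}.

Lemma tlift_scalel_morphM :
  {morph tlift (fun y (z : {malg K[N]}) => e y *: z) : t u / t * u}.
Proof.
apply: (tens_linear_morphM _ (tlift_linear _)); first exact: malg_scaleAr.
move=> y y' z z'; rewrite !tlift_scalelE eM.
by rewrite -scalerAl -(malg_scaleAr (e y')) scalerA.
Qed.

Lemma tlift_scaler_morphM :
  {morph tlift (fun (y : {malg K[N]}) z => e z *: y) : t u / t * u}.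
Proof.
apply: (tens_linear_morphM _ (tlift_linear _)); first exact: malg_scaleAr.
move=> y y' z z'; rewrite !tlift_scalerE eM.
by rewrite -scalerAl -(malg_scaleAr (e z')) scalerA.
Qed.
End TensorContraction.

Section AntiMorphism.
Variables (M : monomType) (S : {malg K[M]} -> {malg K[M]}).
Hypotheses (lS : linear S) (SM : forall x y, S (x * y) = S y * S x).

Lemma tmul_linear : linear (@tmul K M).
Proof. exact: tlift_linear. Qed.

Lemma tmulE (x y : {malg K[M]}) : tmul (x \ot y) = x * y.
Proof. exact: tliftE (mulr_bilinear M). Qed.

Lemma tmul_tmapl x y : tmul (tmap S id (x \ot y)) = S x * y.
Proof. by rewrite tmapE // tmulE. Qed.

Lemma tmul_tmapr x y : tmul (tmap id S (x \ot y)) = x * S y.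
Proof. by rewrite tmapE // tmulE. Qed.

Lemma tmul_tmapl_linear : linear (fun t => tmul (tmap S id t)).
Proof. exact: linear_comp tmul_linear (tmap_linear S id). Qed.

Lemma tmul_tmapr_linear : linear (fun t => tmul (tmap id S t)).
Proof. exact: linear_comp tmul_linear (tmap_linear id S). Qed.

(** In each term S(u1) S(t1) t2 u2 of the left-hand side, the factors coming
    from t are enclosed by those coming from u, and contract first to a central
    scalar.  For the right convolution below, the terms are t1 u1 S(u2) S(t2)
    and it is u that is enclosed. *)
Lemma tmul_tmaplM (t u : tensor K M M) a b :
    tmul (tmap S id t) = a%:A -> tmul (tmap S id u) = b%:A ->
  tmul (tmap S id (t * u)) = (a * b)%:A.
Proof.
pose f v := tmul (tmap S id v); have lf : linear f := tmul_tmapl_linear.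
have fE x y : f (x \ot y) = S x * y := tmul_tmapl x y.
rewrite -/(f t) -/(f u) -/(f (t * u)); move: f lf fE => f lf fE ft fu.
suff fM v : f (t * v) = a *: f v by rewrite fM fu scalerA.
elim/tens_ind: v => [c v v' ev ev'|y z].
  by rewrite mulrDr -malg_scaleAr !lf ev ev' scalerDr !scalerA [a * c]mulrC.
suff -> : f (t * (y \ot z)) = S y * f t * z.
  by rewrite ft fE -malg_scaleAr mulr1 scalerAl.
elim/tens_ind: t {ft} => [c t t' et et'|y' z'].
  by rewrite mulrDl -scalerAl !lf mulrDr -malg_scaleAr mulrDl -scalerAl et et'.
by rewrite tensM !fE SM !mulrA.
Qed.

Lemma tmul_tmaprM (t u : tensor K M M) a b :
    tmul (tmap id S t) = a%:A -> tmul (tmap id S u) = b%:A ->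
  tmul (tmap id S (t * u)) = (a * b)%:A.
Proof.
pose f v := tmul (tmap id S v); have lf : linear f := tmul_tmapr_linear.
have fE x y : f (x \ot y) = x * S y := tmul_tmapr x y.
rewrite -/(f t) -/(f u) -/(f (t * u)); move: f lf fE => f lf fE ft fu.
suff fM v : f (v * u) = b *: f v by rewrite fM ft scalerA mulrC.
elim/tens_ind: v => [c v v' ev ev'|y z].
  by rewrite mulrDl -scalerAl !lf ev ev' scalerDr !scalerA [b * c]mulrC.
suff -> : f ((y \ot z) * u) = y * f u * S z.
  by rewrite fu fE -malg_scaleAr mulr1 scalerAl.
elim/tens_ind: u {fu} => [c u u' eu eu'|y' z'].
  rewrite mulrDr -malg_scaleAr !lf mulrDr -malg_scaleAr mulrDl -scalerAl.
  by rewrite eu eu'.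
by rewrite tensM !fE SM !mulrA.
Qed.
End AntiMorphism.
End LinearMaps.

(** * Supports *)

Section Supports.
Variable K : fieldType.

Section Supported.
Variable M : monomType.
Implicit Types (D : M -> Prop) (x y : {malg K[M]}).

Definition supported D x := forall m, m \in msupp x -> D m.

Lemma supported0 D : supported D 0.
Proof. by move=> m; rewrite msupp0 in_fset0. Qed.

Lemma supportedU D m : D m -> supported D << m >>.
Proof. by move=> Dm m'; rewrite msuppU1 in_fset1 => /eqP->. Qed.

Lemma supportedP D c x y :
  supported D x -> supported D y -> supported D (c *: x + y).
Proof.
move=> Dx Dy m /(fsubsetP (msuppD_le _ _)); rewrite in_fsetU => /orP[];
  last exact: Dy.
by move/(fsubsetP (msuppZ_le _ _)); apply: Dx.
Qed.

Lemma supportedD D x y : supported D x -> supported D y -> supported D (x + y).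
Proof. by move=> Dx Dy; rewrite -[x]scale1r; apply: supportedP. Qed.

Lemma supportedZ D c x : supported D x -> supported D (c *: x).
Proof.
by move=> Dx; rewrite -[_ *: _]addr0; apply: supportedP (supported0 D).
Qed.

Lemma supported_sum D I (r : seq I) (P : pred I) (F : I -> {malg K[M]}) :
    (forall i, P i -> supported D (F i)) ->
  supported D (\sum_(i <- r | P i) F i).
Proof.
move=> DF; elim/big_rec: _ => [|i x Pi Dx]; first exact: supported0.
by apply: supportedD (DF i Pi) Dx.
Qed.

Lemma supportedM D D' D'' x y :
    (forall m n, D m -> D' n -> D'' (mmul m n)) ->
  supported D x -> supported D' y -> supported D'' (x * y).
Proof.
move=> DD Dx Dy m /msuppM_le[m1 [m2 [/Dx D1 /Dy D2 ->]]]; exact: DD.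
Qed.
End Supported.

Lemma supported_tens (M N : monomType) (D : M -> Prop) (D' : N -> Prop)
    (D'' : M * N -> Prop) (x : {malg K[M]}) (y : {malg K[N]}) :
    (forall m n, D m -> D' n -> D'' (m, n)) ->
  supported D x -> supported D' y -> supported D'' (x \ot y).
Proof.
move=> DD Dx Dy [m n]; rewrite -mcoeff_neq0 tensE mulf_eq0 negb_or !mcoeff_neq0.
by case/andP=> /Dx Dm /Dy Dn; apply: DD.
Qed.

Lemma supported_lin (M N : monomType) (D : M -> Prop) (D' : N -> Prop)
    (f : {malg K[M]} -> {malg K[N]}) x :
    linear f -> (forall m, D m -> supported D' (f << m >>)) ->
  supported D x -> supported D' (f x).
Proof.
move=> lf fD Dx; rewrite (malg_lin x lf) big_seq.
by apply: supported_sum => m /Dx Dm; apply: supportedZ (fD m Dm).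
Qed.
End Supports.

(** * Powers of a power series, and unitriangular systems *)

Section SeriesPowers.
Variable A : nzRingType.
Implicit Types f : nat -> A.

Lemma series_expS f k n :
  series_exp f k.+1 n = \sum_(i < n.+1) f i * series_exp f k (n - i).
Proof. by []. Qed.

(** Truncation: powers of a power series are read off powers of a polynomial,
    where the ring laws are available. *)
Lemma series_exp_poly f k N n : (n < N)%N ->
  series_exp f k n = ((\poly_(i < N) f i) ^+ k)`_n.
Proof.
elim: k n => [|k IHk] n nN; first by rewrite expr0 coef1.
rewrite exprS coefM /series_exp /= /series_mul; apply: eq_bigr => i _.
rewrite coef_poly (leq_ltn_trans _ nN) -1?ltnS //; congr (_ * _).
by rewrite [LHS]IHk // (leq_ltn_trans (leq_subr _ _)).
Qed.

Lemma series_exp1 f n : series_exp f 1 n = f n.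
Proof. by rewrite (series_exp_poly _ _ (ltnSn n)) expr1 coef_poly ltnSn. Qed.

Lemma series_expD f k l n :
  series_exp f (k + l) n =
    \sum_(i < n.+1) series_exp f k i * series_exp f l (n - i).
Proof.
rewrite (series_exp_poly _ _ (ltnSn n)) exprD coefM.
by apply: eq_bigr => i _; rewrite -!series_exp_poly // ltnS leq_subr.
Qed.

Lemma series_exp_diag f n : f 0%N = 0 -> f 1%N = 1 -> series_exp f n n = 1.
Proof.
move=> f0 f1; elim: n => [|n IHn]; first by [].
rewrite series_expS 2!big_ord_recl f0 f1 mul0r add0r mul1r subn1 IHn.
rewrite big1 ?addr0 // => i _; rewrite (series_exp_small f0) ?mulr0 //.
by case: n i {IHn} => [[]|n i] //; rewrite subSS ltn_subrL.
Qed.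
End SeriesPowers.

(** Regrouping by i = k + l; the vanishing hypothesis discards the part of the
    square that lies beyond the last antidiagonal. *)
Lemma sum_antidiagonal (V : nmodType) (G : nat -> nat -> V) N :
    (forall k l, (N <= k + l)%N -> G k l = 0) ->
  \sum_(k < N) \sum_(l < N) G k l = \sum_(i < N) \sum_(k < i.+1) G k (i - k)%N.
Proof.
move=> G0; apply/esym; transitivity
  (\sum_(i < N) \sum_(k < N | (k <= i)%N) G k (i - k)%N).
  by apply: eq_bigr => i _; rewrite (big_ord_widen N (fun k => G k (i - k)%N)).
rewrite (exchange_big_dep predT) //=; apply: eq_bigr => k _.
rewrite -(big_geq_mkord _ _ predT (fun i => G k (i - k)%N)).
rewrite -{1}[val k]add0n big_addn.
rewrite -(big_mkord predT (G k)) [RHS](big_cat_nat (n := N - k)) ?leq_subr //=.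
rewrite [X in _ = _ + X]big_nat_cond [X in _ = _ + X]big1 ?addr0 => [|l].
  by apply: eq_big => // l _; rewrite addnK.
by rewrite andbT => /andP[le _]; rewrite G0 // -leq_subLR.
Qed.

Section Unitriangular.
Variable A : nzRingType.
Implicit Types M T : nat -> nat -> A.

(** The equations determine the u n one after the other, each u n occurring in
    equation n with coefficient 1.  The list us m collects the first m values,
    because each one depends on all the preceding ones. *)
Lemma unitriangular_solve M (v : nat -> A) : (forall n, M n n = 1) ->
  exists u : nat -> A, forall n, \sum_(i < n.+1) u i * M i n = v n.
Proof.
move=> M1.
pose us := fix us n := if n is m.+1 then
  rcons (us m) (v m - \sum_(i < m) (us m)`_i * M i m) else [::].
have us_size n : size (us n) = n.
  by elim: n => //= n IHn; rewrite size_rcons IHn.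
have usE n i : (i < n)%N -> (us n)`_i = (us i.+1)`_i.
  elim: n => // n IHn; rewrite ltnS leq_eqVlt => /predU1P[-> //|lt_in].
  by rewrite -IHn //= nth_rcons us_size lt_in.
have [u uE] : exists u : nat -> A,
    forall n, u n = v n - \sum_(i < n) u i * M i n.
  exists (fun i => (us i.+1)`_i) => n.
  rewrite {1}/us nth_rcons us_size ltnn eqxx.
  by congr (_ - _); apply: eq_bigr => i _; rewrite -(usE n).
by exists u => n; rewrite big_ord_recr /= M1 mulr1 uE addrC subrK.
Qed.

(** Like M, the matrix T has a left inverse U, and then
    U = U (T M) = (U T) M = M, so that M T = U T = 1. *)
Lemma unitriangular_linv_rinv M T :
    (forall i n, (n < i)%N -> M i n = 0) ->
    (forall i n, (n < i)%N -> T i n = 0) -> (forall n, T n n = 1) ->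
    (forall j n, \sum_(i < n.+1) T j i * M i n = (j == n)%:R) ->
  forall j n, \sum_(i < n.+1) M j i * T i n = (j == n)%:R.
Proof.
move=> M0 T0 T1 TM j n.
have [u uT] := unitriangular_solve (fun n => (j == n)%:R) T1.
suff uM m : u m = M j m by rewrite -(uT n); apply: eq_bigr => i _; rewrite uM.
(* Triangularity extends the sums for U T to a common range of summation, as
   needed to exchange them with those for T M. *)
have widen (F : nat -> A) k : (k < m.+1)%N ->
    (forall i, (k < i)%N -> F i = 0) ->
  \sum_(i < m.+1) F i = \sum_(i < k.+1) F i.
  move=> km F0; rewrite [RHS](big_ord_widen m.+1 F) //.
  rewrite [LHS](bigID (fun i : 'I_m.+1 => i < k.+1)%N) /=.
  by rewrite [X in _ + X]big1 ?addr0 // => i; rewrite -leqNgt => /F0.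
transitivity (\sum_(k < m.+1) (\sum_(i < m.+1) u i * T i k) * M k m).
  under eq_bigr do rewrite mulr_suml.
  rewrite exchange_big /= big_ord_recr /= big1 ?add0r.
    by under eq_bigr do rewrite -mulrA; rewrite -mulr_sumr TM eqxx mulr1.
  move=> i _; under eq_bigr do rewrite -mulrA.
  by rewrite -mulr_sumr TM ltn_eqF ?mulr0.
transitivity (\sum_(k < m.+1) (j == k)%:R * M k m).
  apply: eq_bigr => k _; congr (_ * _); rewrite -uT.
  by rewrite (widen (fun i => u i * T i k) k) // => i ki; rewrite T0 ?mulr0.
have [jm|mj] := ltnP j m.+1.
  rewrite (bigD1 (Ordinal jm)) //= eqxx mul1r big1 ?addr0 // => i.
  by rewrite -val_eqE eq_sym /= => /negbTE->; rewrite mul0r.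
rewrite M0 // big1 // => i _; rewrite gtn_eqF ?mul0r //.
exact: leq_trans (ltn_ord i) mj.
Qed.
End Unitriangular.

(** * The free algebra and its co-product *)

Section Dif.
Variable K : fieldType.

Local Notation Hdif := {malg K[{fmonom nat}]}.
Local Notation HHdif := (tensor K {fmonom nat} {fmonom nat}).
Local Notation A := (dif_series K).
Local Notation Delta := (@dif_comult K).
Local Notation eps := (@dif_counit K).

Lemma fmonom1E : mone = FMonom [::] :> {fmonom nat}.
Proof. by apply/eqP; rewrite fmP fm1. Qed.

Lemma fmonomME (w w' : {fmonom nat}) : mmul w w' = FMonom (w ++ w').
Proof. by apply/eqP; rewrite fmP fmM. Qed.

(** The generators enter as the coefficients A n of A(x), which include the
    constants A 0 = 0 and A 1 = 1, so that each step on generators can treat all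
    the coefficients of the series at once. *)
Lemma dif_ind (P : Hdif -> Prop) :
    (forall c x y, P x -> P y -> P (c *: x + y)) -> P 1 ->
    (forall x y, P x -> P y -> P (x * y)) -> (forall n, P (A n)) ->
  forall x, P x.
Proof.
move=> PD P1 PM PA; apply: malg_ind => // -[s].
elim: s => [|i s IHs]; first by rewrite -fmonom1E.
suff -> : << FMonom (i :: s) >> = A i.+2 * << FMonom s >> :> Hdif by apply: PM.
by rewrite /= -malgUM fmonomME fmU.
Qed.

Lemma eq_dif_morph (B : lalgType K) (f g : Hdif -> B) :
    linear f -> linear g -> f 1 = g 1 ->
    {morph f : x y / x * y} -> {morph g : x y / x * y} ->
  (forall n, f (A n) = g (A n)) -> f =1 g.
Proof.
move=> lf lg fg1 fM gM fgA; elim/dif_ind => // [c x y ex ey|x y ex ey].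
  by rewrite lf lg ex ey.
by rewrite fM gM ex ey.
Qed.

Section FreeExt.
Variables (B : lalgType K) (g : nat -> B).

Lemma free_ext_linear : linear (free_ext g).
Proof. exact: basis_ext_linear. Qed.

Lemma free_extU w : free_ext g << w >> = \prod_(i <- (w : seq nat)) g i.+1.
Proof. exact: basis_extU. Qed.

Lemma free_ext1 : free_ext g 1 = 1.
Proof. by rewrite free_extU fm1 big_nil. Qed.

Lemma free_ext_morphM : (forall c (x y : B), c *: (x * y) = x * (c *: y)) ->
  {morph free_ext g : x y / x * y}.
Proof.
move=> BZ; apply: (malg_linear_morphM BZ free_ext_linear) => w w'.
by rewrite !free_extU fmM big_cat.
Qed.
End FreeExt.

Lemma dif_comult_linear : linear Delta.
Proof. exact: free_ext_linear. Qed.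

Lemma dif_comult1 : Delta 1 = 1.
Proof. exact: free_ext1. Qed.

Lemma dif_comultM : {morph Delta : x y / x * y}.
Proof. by apply: free_ext_morphM; apply: malg_scaleAr. Qed.

Lemma dif_counit_linear : scalar eps.
Proof. exact: (free_ext_linear (B := K^o)). Qed.

Lemma dif_counit1 : eps 1 = 1.
Proof. exact: (free_ext1 (B := K^o)). Qed.

Lemma dif_counitM : {morph eps : x y / x * y}.
Proof.
by apply: (free_ext_morphM (B := K^o)) => c x y; apply: mulrCA.
Qed.

Lemma dif_counit0 : eps 0 = 0.
Proof. exact: (linear_fun0 (W := K^o) dif_counit_linear). Qed.

Lemma dif_counit_sum I (r : seq I) (P : pred I) F :
  eps (\sum_(i <- r | P i) F i) = \sum_(i <- r | P i) eps (F i).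
Proof. exact: (linear_fun_sum (W := K^o) dif_counit_linear). Qed.

Lemma dif_counit_series n : eps (A n) = (n == 1%N)%:R.
Proof.
case: n => [|[|n]]; [exact: dif_counit0|exact: dif_counit1|].
exact: (free_ext_a (B := K^o)).
Qed.

(** * The matrix of coefficients of the powers of A(x) *)

(** Arranging the powers of A(x) as the rows of an infinite upper unitriangular
    matrix turns the formula for the co-product into a matrix product. *)
Definition dif_mx (j n : nat) : Hdif := series_exp A j n.
Arguments dif_mx : simpl never.

Lemma dif_mx0 n : dif_mx 0 n = (n == 0%N)%:R.
Proof. by []. Qed.

Lemma dif_mx1 n : dif_mx 1 n = A n.
Proof. exact: series_exp1. Qed.

Lemma dif_mxS j n :
  dif_mx j.+1 n = \sum_(m < n.+1) A m * dif_mx j (n - m).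
Proof. by []. Qed.

Lemma dif_mx_lower j n : (n < j)%N -> dif_mx j n = 0.
Proof. exact: series_exp_small. Qed.

Lemma dif_mx_diag n : dif_mx n n = 1.
Proof. exact: series_exp_diag. Qed.

Lemma dif_comult_series_mx n :
  Delta (A n) = \sum_(i < n.+1) A i \ot dif_mx i n.
Proof. by rewrite dif_comult_series dif_kernelE. Qed.

(** The matrix is group-like.  By induction on j, this comes down to
    A^k A^l = A^(k + l) in the right factor, after collecting the terms with a
    given k + l.  The bound N is left free, because the induction
    uses the formula for several columns with a common range of summation. *)
Lemma dif_comult_mx j n N : (n < N)%N ->
  Delta (dif_mx j n) = \sum_(i < N) dif_mx j i \ot dif_mx i n.
Proof.
elim: j n => [|j IHj] n nN.
  case: N nN => // N _; rewrite big_ord_recl big1 ?addr0 => [|i _].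
    rewrite !dif_mx0 eqxx; case: eqP => _; last first.
      by rewrite tens0r (linear_fun0 dif_comult_linear).
    by rewrite dif_comult1 tens11.
  by rewrite dif_mx0 tens0l.
have Delta_A m : (m < N)%N -> Delta (A m) = \sum_(k < N) A k \ot dif_mx k m.
  move=> mN; rewrite dif_comult_series_mx.
  rewrite (big_ord_widen N (fun i => A i \ot dif_mx i m)) // big_mkcond.
  apply: eq_bigr => i _; case: ltnP => // im.
  by rewrite dif_mx_lower ?tens0r.
transitivity (\sum_(k < N) \sum_(l < N)
    (A k * dif_mx j l) \ot dif_mx (k + l) n).
  rewrite dif_mxS (linear_fun_sum dif_comult_linear).
  transitivity (\sum_(m < n.+1) \sum_(k < N) \sum_(l < N)
      (A k * dif_mx j l) \ot (dif_mx k m * dif_mx l (n - m))).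
    apply: eq_bigr => m _; rewrite dif_comultM Delta_A; last first.
      exact: leq_trans (ltn_ord m) nN.
    rewrite IHj ?(leq_ltn_trans (leq_subr _ _)) // mulr_suml.
    apply: eq_bigr => k _; rewrite mulr_sumr.
    by apply: eq_bigr => l _; rewrite tensM.
  rewrite exchange_big; apply: eq_bigr => k _.
  rewrite exchange_big; apply: eq_bigr => l _.
  by rewrite -tens_sumr /dif_mx series_expD.
rewrite (sum_antidiagonal
  (G := fun k l => (A k * dif_mx j l) \ot dif_mx (k + l) n)); last first.
  move=> k l le; rewrite (dif_mx_lower (leq_trans nN le)).
  exact: tens0r.
apply: eq_bigr => i _; rewrite dif_mxS tens_suml.
by apply: eq_bigr => k _; rewrite subnKC // -ltnS.
Qed.

Lemma dif_counit_mx j n : eps (dif_mx j n) = (j == n)%:R.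
Proof.
elim: j n => [|j IHj] n.
  rewrite dif_mx0 eq_sym; case: eqP => _; first exact: dif_counit1.
  exact: dif_counit0.
rewrite dif_mxS dif_counit_sum.
under eq_bigr do rewrite dif_counitM dif_counit_series IHj.
case: n => [|n]; first by rewrite big_ord1 mul0r.
rewrite 2!big_ord_recl big1 => [|i _]; last by rewrite mul0r.
by rewrite mul0r add0r mul1r addr0 eqSS subSS subn0.
Qed.

(** * The bialgebra *)

(** On A(x), both sides are the first row of the triple matrix product. *)
Lemma dif_coassoc x :
  tassoc (tmap Delta id (Delta x)) = tmap id Delta (Delta x).
Proof.
have lD := dif_comult_linear; have DM := dif_comultM.
have lI : linear (@id Hdif) by [].
have lDI := tmap_linear Delta (@id Hdif).
have lID := tmap_linear (@id Hdif) Delta.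
have lT := @tassoc_linear K {fmonom nat} {fmonom nat} {fmonom nat}.
have DIM := tmap_morphM lD lI DM (fun _ _ => erefl).
have IDM := tmap_morphM lI lD (fun _ _ => erefl) DM.
apply: (eq_dif_morph (f := fun x => tassoc (tmap Delta id (Delta x)))
                     (g := fun x => tmap id Delta (Delta x))) => {x}.
- exact: linear_comp lT (linear_comp lDI lD).
- exact: linear_comp lID lD.
- by rewrite dif_comult1 -tens11 !tmapE // dif_comult1 -!tens11 tassocE.
- by move=> x y; rewrite DM DIM tassoc_morphM.
- by move=> x y; rewrite DM IDM.
move=> n.
rewrite dif_comult_series_mx (linear_fun_sum lDI) (linear_fun_sum lID).
rewrite (linear_fun_sum lT).
transitivity (\sum_(i < n.+1) \sum_(k < n.+1)
    A k \ot (dif_mx k i \ot dif_mx i n)).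
  apply: eq_bigr => i _; rewrite tmapE // -dif_mx1.
  rewrite (dif_comult_mx _ (ltn_ord i)) tens_suml (linear_fun_sum lT).
  by apply: eq_bigr => k _; rewrite tassocE dif_mx1.
rewrite exchange_big; apply: eq_bigr => i _.
by rewrite tmapE // (dif_comult_mx i (ltnSn n)) tens_sumr.
Qed.

(** The co-unit maps the matrix to the identity matrix, which is why it is
    neutral for the matrix product. *)
Lemma dif_counitl x : tlift (fun y z => eps y *: z) (Delta x) = x.
Proof.
have fE := tlift_scalelE (N := {fmonom nat}) dif_counit_linear.
have lf : linear _ := tlift_linear (fun y z : Hdif => eps y *: z).
have fM := tlift_scalel_morphM (N := {fmonom nat}) dif_counit_linear
  dif_counitM.
move: (tlift _) lf fE fM => f lf fE fM.
apply: (eq_dif_morph (f := fun x => f (Delta x)) (g := id)) => {x} //.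
- exact: linear_comp lf dif_comult_linear.
- by rewrite dif_comult1 -tens11 fE dif_counit1 scale1r.
- by move=> x y; rewrite dif_comultM; apply: fM.
move=> n.
(* With n + 2 terms, the index 1 of the only nonzero term is in range also when
   n = 0. *)
rewrite -dif_mx1 (dif_comult_mx _ (ltnW (ltnSn n.+1))) (linear_fun_sum lf).
rewrite (bigD1 (Ordinal (isT : 1 < n.+2)%N)) //= big1 => [|i].
  by rewrite fE dif_counit_mx eqxx scale1r addr0.
rewrite -val_eqE /= eq_sym => /negbTE i1.
by rewrite fE dif_counit_mx i1 scale0r.
Qed.

Lemma dif_counitr x : tlift (fun y z => eps z *: y) (Delta x) = x.
Proof.
have fE := tlift_scalerE (N := {fmonom nat}) dif_counit_linear.
have lf : linear _ := tlift_linear (fun y z : Hdif => eps z *: y).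
have fM := tlift_scaler_morphM (N := {fmonom nat}) dif_counit_linear
  dif_counitM.
move: (tlift _) lf fE fM => f lf fE fM.
apply: (eq_dif_morph (f := fun x => f (Delta x)) (g := id)) => {x} //.
- exact: linear_comp lf dif_comult_linear.
- by rewrite dif_comult1 -tens11 fE dif_counit1 scale1r.
- by move=> x y; rewrite dif_comultM; apply: fM.
move=> n.
rewrite dif_comult_series_mx (linear_fun_sum lf) big_ord_recr big1 => [|i _] /=.
  by rewrite fE dif_counit_mx eqxx scale1r add0r.
by rewrite fE dif_counit_mx ltn_eqF ?scale0r.
Qed.

(** * The antipode *)

Section Antipode.
Variable u : nat -> Hdif.
Hypothesis uE : forall n, \sum_(i < n.+1) u i * dif_mx i n = (1%N == n)%:R.

(** The letter i of a word stands for the coefficient of x^(i + 2) in A(x),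
    whence the shift.  The equations uE say that u is row 1 of the left inverse
    of the matrix; they are the left antipode identity on the A n. *)
Definition dif_antipode : Hdif -> Hdif :=
  basis_ext (fun w : {fmonom nat} => \prod_(i <- rev w) u i.+2).
Local Notation S := dif_antipode.

Lemma dif_antipode_linear : linear S.
Proof. exact: basis_ext_linear. Qed.

Lemma dif_antipode1 : S 1 = 1.
Proof. by rewrite [LHS]basis_extU fm1 big_nil. Qed.

Lemma dif_antipodeM x y : S (x * y) = S y * S x.
Proof.
apply: (malg_linear_antimorphM dif_antipode_linear) => w w'.
by rewrite /S !basis_extU fmM rev_cat big_cat.
Qed.

Lemma dif_antipode_series n : S (A n) = u n.
Proof.
have u0 : u 0%N = 0 by have := uE 0; rewrite big_ord1 dif_mx_diag mulr1.
case: n => [|[|n]].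
- by rewrite u0 (linear_fun0 dif_antipode_linear).
- rewrite dif_antipode1; have := uE 1.
  by rewrite 2!big_ord_recl big_ord0 u0 mul0r add0r addr0 dif_mx_diag mulr1.
by rewrite [LHS]basis_extU fmU big_seq1.
Qed.

(** With f the convolution S * id or id * S, this reduces the antipode
    identities to the generators. *)
Lemma convolution_dif_ind (f : HHdif -> Hdif) :
    linear f -> f 1 = 1 ->
    (forall t t' a b, f t = a%:A -> f t' = b%:A -> f (t * t') = (a * b)%:A) ->
    (forall n, f (Delta (A n)) = (eps (A n))%:A) ->
  forall x, f (Delta x) = (eps x)%:A.
Proof.
move=> lf f1 fM.
have := dif_comult_linear; have := dif_comult1; have := dif_comultM.
have := dif_counit_linear; have := dif_counit1; have := dif_counitM.
move: Delta eps => D e eM e1 le DM D1 lD fA; apply: dif_ind; last exact: fA.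
- by move=> c x y ex ey; rewrite lD lf ex ey le scalerDl scalerA.
- by rewrite D1 f1 e1 scale1r.
by move=> x y ex ey; rewrite (DM x y) (eM x y); apply: fM ex ey.
Qed.

Lemma dif_antipodel x : tmul (tmap S id (Delta x)) = (eps x)%:A.
Proof.
have lS := dif_antipode_linear; have lf := tmul_tmapl_linear S.
apply: (convolution_dif_ind lf) => [||n].
- by rewrite -tens11 (tmul_tmapl lS) dif_antipode1 mulr1.
- exact: tmul_tmaplM lS dif_antipodeM.
rewrite dif_comult_series_mx (linear_fun_sum lf) dif_counit_series scaler_nat.
rewrite eq_sym -uE; apply: eq_bigr => i _.
by rewrite (tmul_tmapl lS) dif_antipode_series.
Qed.

(** On the coefficients of A(x), the right identity is the first row of an
    identity of matrices M T = 1, where T is the entrywise image of M under the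
    antipode; the left identity, applied to all coefficients of all powers,
    says that T M = 1. *)
Lemma dif_antipoder x : tmul (tmap id S (Delta x)) = (eps x)%:A.
Proof.
have lS := dif_antipode_linear; have lf := tmul_tmapr_linear S.
apply: (convolution_dif_ind lf) => [||n].
- by rewrite -tens11 (tmul_tmapr lS) dif_antipode1 mulr1.
- exact: tmul_tmaprM lS dif_antipodeM.
rewrite dif_comult_series_mx (linear_fun_sum lf) dif_counit_series scaler_nat.
transitivity (\sum_(i < n.+1) dif_mx 1 i * S (dif_mx i n)).
  by apply: eq_bigr => i _; rewrite (tmul_tmapr lS) dif_mx1.
rewrite eq_sym.
apply: (unitriangular_linv_rinv (T := fun j i => S (dif_mx j i))).
- exact: dif_mx_lower.
- by move=> j i ij; rewrite dif_mx_lower // (linear_fun0 lS).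
- by move=> j; rewrite dif_mx_diag dif_antipode1.
move=> j m; have := dif_antipodel (dif_mx j m).
rewrite dif_counit_mx scaler_nat => <-; rewrite (dif_comult_mx _ (ltnSn m)).
rewrite (linear_fun_sum (tmul_tmapl_linear S)).
by apply: eq_bigr => i _; rewrite (tmul_tmapl lS).
Qed.
End Antipode.

(** * The grading *)

Lemma dif_degree1 : dif_degree mone = 0%N.
Proof. by rewrite /dif_degree fm1 big_nil. Qed.

Lemma dif_degreeM w w' :
  dif_degree (mmul w w') = (dif_degree w + dif_degree w')%N.
Proof. by rewrite /dif_degree fmM big_cat. Qed.

(** The coefficient of x^n in A(x)^j has degree n - j; the equation avoids the
    truncated subtraction. *)
Lemma dif_mx_degree j n :
  supported (fun w => (dif_degree w + j)%N = n) (dif_mx j n).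
Proof.
elim: j n => [|j IHj] n.
  rewrite dif_mx0; case: eqP => [->|_]; last exact: supported0.
  by apply: supportedU; rewrite dif_degree1.
rewrite dif_mxS; apply: supported_sum => m _.
apply: (supportedM (D := fun w => (dif_degree w + 1)%N = m)); last exact: IHj.
  move=> w w' ew ew'; rewrite dif_degreeM -[j.+1]add1n addnACA ew ew' subnKC //.
  by rewrite -ltnS.
case: {IHj} m => -[|[|m]] /= _; first exact: supported0.
  by apply: supportedU; rewrite dif_degree1.
by apply: supportedU; rewrite /dif_degree fmU big_seq1 addn1.
Qed.

Lemma malgU_cons i (s : seq nat) :
  << FMonom (i :: s) >> = A i.+2 * << FMonom s >> :> Hdif.
Proof. by rewrite /= -malgUM fmonomME fmU. Qed.

Lemma dif_degree_cons i (s : seq nat) :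
  dif_degree (FMonom (i :: s)) = (i.+1 + dif_degree (FMonom s))%N.
Proof. exact: big_cons. Qed.

Lemma dif_comultU_degree w :
  supported (fun p => (dif_degree p.1 + dif_degree p.2)%N = dif_degree w)
    (Delta << w >>).
Proof.
case: w; elim=> [|i s IHs].
  rewrite -fmonom1E [Delta _]dif_comult1; apply: supportedU.
  by rewrite /= !dif_degree1.
rewrite malgU_cons dif_comultM.
apply: (supportedM (D := fun p => (dif_degree p.1 + dif_degree p.2).+1 = i.+2)
  _ _ IHs) => [[w1 w2] [w1' w2'] /= [e] e'|].
  by rewrite !dif_degreeM addnACA e e' dif_degree_cons.
rewrite dif_comult_series_mx; apply: supported_sum => k _.
rewrite -dif_mx1.
apply: supported_tens (@dif_mx_degree _ _) (@dif_mx_degree _ _).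
by move=> w w' /= ek <-; rewrite -[in RHS]ek addn1 addnS addnC.
Qed.

Lemma tens_grading_supported n (t : HHdif) :
    supported (fun p => (dif_degree p.1 + dif_degree p.2)%N = n) t ->
  tens_grading (@dif_homog K) (@dif_homog K) n t.
Proof.
move=> Dt; pose p (k : 'I_(size (msupp t))) := tnth (in_tuple (msupp t)) k.
exists (size (msupp t)), (fun k => t@_(p k) *: << (p k).1 >>),
  (fun k => << (p k).2 >>); split=> [k|].
  exists (dif_degree (p k).1), (dif_degree (p k).2); split.
  - by apply: Dt; apply: mem_tnth.
  - by apply: supportedZ; apply: supportedU.
  - exact: supportedU.
rewrite {1}(malg_lin (f := id) t) // big_tnth; apply: eq_bigr => k _.
rewrite (linear_funZ (proj1 (tens_bilinear K _ _) _)) tensUU.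
by rewrite -surjective_pairing.
Qed.

Lemma dif_antipode_degree (u : nat -> Hdif) n x :
    (forall n, \sum_(i < n.+1) u i * dif_mx i n = (1%N == n)%:R) ->
  dif_homog n x -> dif_homog n (dif_antipode u x).
Proof.
move=> uE.
have u_degree k : supported (fun w => (dif_degree w + 1)%N = k) (u k).
  have [m] := ubnP k; elim: m k => // m IHm k; rewrite ltnS => km.
  have -> : u k = (1%N == k)%:R + (-1) *: \sum_(i < k) u i * dif_mx i k.
    rewrite -uE big_ord_recr /= dif_mx_diag mulr1 scaleN1r.
    by rewrite addrAC subrr add0r.
  apply: supportedD; [|apply: supportedZ; apply: supported_sum => i _].
    case: eqP => [<-|_]; last exact: supported0.
    by apply: supportedU; rewrite dif_degree1.
  apply: supportedM (IHm i (leq_trans (ltn_ord i) km)) (@dif_mx_degree i k).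
  by move=> w w' /= ew <-; rewrite dif_degreeM -[in RHS]ew addnAC addnC.
move=> homx; apply: (supported_lin (dif_antipode_linear u) _ homx) => w <-.
case: w; elim=> [|i s IHs].
  rewrite -fmonom1E [dif_antipode _ _]dif_antipode1; exact: supportedU.
rewrite malgU_cons dif_antipodeM (dif_antipode_series uE).
apply: supportedM IHs (@u_degree _) => w w' ew.
by rewrite addn1 dif_degreeM ew dif_degree_cons addnC => -[->].
Qed.

Lemma dif_homog_grading : is_grading (@dif_homog K).
Proof.
split=> [n|n c x y|x|N c homc].
- exact: supported0.
- exact: supportedP.
- pose c n : Hdif := \sum_(w <- msupp x | dif_degree w == n) x@_w *: << w >>.
  exists (\max_(w <- msupp x) dif_degree w).+1, c; split=> [n|].
    apply: supported_sum => w /eqP ew; apply: supportedZ.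
    exact: supportedU.
  rewrite /c (exchange_big_dep predT) //= {1}(malg_lin (f := id) x) //.
  rewrite [LHS]big_seq [RHS]big_seq; apply: eq_bigr => w wx.
  have ltN : (dif_degree w < (\max_(w <- msupp x) dif_degree w).+1)%N.
    by rewrite ltnS (leq_bigmax_seq _ wx).
  by rewrite (big_pred1 (Ordinal ltN)).
move=> c0 n nN; apply/malgP=> w; rewrite mcoeff0.
have [ew|/eqP ew] := eqVneq (dif_degree w) n; last first.
  by apply: mcoeff_outdom; apply/negP => /homc.
have := congr1 (mcoeff w) c0; rewrite raddf_sum mcoeff0.
rewrite (bigD1 (Ordinal nN)) //= big1 ?addr0 // => i; rewrite -val_eqE /= => ni.
apply: mcoeff_outdom; apply/negP => /homc; rewrite ew => en.
by rewrite en eqxx in ni.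
Qed.

Lemma dif_homog_connected : is_connected (@dif_homog K).
Proof.
move=> x; split=> [homx|[c ->]]; last first.
  by apply: supportedZ; apply: supportedU; apply: dif_degree1.
exists x@_mone; apply/malgP=> w; rewrite mcoeffZ mcoeff1.
have [->|w1] := eqVneq w mone; first by rewrite mulr1.
rewrite mulr0; apply: mcoeff_outdom; apply: contra w1 => /homx.
by case: w => -[|i s]; [rewrite fmonom1E|rewrite dif_degree_cons].
Qed.

(** * Failure of commutativity and of co-commutativity *)

Lemma dif_not_commutative : ~ commutative (fun x y : Hdif => x * y).
Proof.
move=> /(_ (dif_a K 1) (dif_a K 2)) /(congr1 (mcoeff (mmul (fmu 0) (fmu 1)))).
rewrite /= -!malgUM !mcoeffU1 eqxx fmP !fmM !fmU /= => /eqP.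
by rewrite oner_eq0.
Qed.

(** The left tensor factors of the co-product of a_3 are linear in the
    variables, whereas a_1 a_1 occurs as a right factor: the monomials
    (a_1, a_1 a_1) and (a_1 a_1, a_1) have coefficients 1 and 0. *)
Lemma dif_not_cocommutative : ~ cocommutative Delta.
Proof.
pose w1 : {fmonom nat} := fmu 0; pose w11 := mmul w1 w1.
have A11 n : (A n)@_w11 = 0.
  case: n => [|[|n]]; first exact: mcoeff0.
    by rewrite mcoeff1 fmP /w11 fm1 fmM fmU.
  by rewrite mcoeffU1 fmP /w11 fmM /w1 !fmU /= eqseq_cons andbF.
(* A 4 is a_3. *)
move=> cocomm; have := congr1 (mcoeff (w11, w1)) (cocomm (A 4)).
rewrite mcoeff_tflip dif_comult_series_mx !raddf_sum /=.
rewrite [RHS]big1 => [|i _]; last by rewrite tensE A11 mul0r.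
have A1 i : (A i)@_w1 = (i == 2)%:R.
  case: i => [|[|i]]; first exact: mcoeff0.
    by rewrite mcoeff1 fmP fm1 /w1 fmU.
  by rewrite mcoeffU1 fmP /w1 !fmU eqseq_cons andbT.
rewrite (bigD1 (inord 2)) //= inordK // big1 ?addr0; last first.
  move=> i; rewrite -val_eqE /= inordK // => /negbTE i2.
  by rewrite tensE A1 i2 mul0r.
rewrite tensE A1 mul1r dif_mxS raddf_sum /=.
(* Of the terms of the coefficient of x^4 in A(x)^2, namely a_2 + a_1 a_1 + a_2,
   only the middle one contributes. *)
rewrite 5!big_ord_recl big_ord0 !dif_mx1 /= mul0r mul1r mulr0 mulr1 -malgUM.
rewrite mcoeff0 !mcoeffU1 eqxx !fmP !fmM !fmU /= !addr0 !add0r => /eqP.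
by rewrite oner_eq0.
Qed.
End Dif.

Theorem theorem2p11 (R : realType) :
  (exists S : {malg R[i][{fmonom nat}]} -> {malg R[i][{fmonom nat}]},
     is_graded_hopf_algebra (@dif_comult R[i]) (@dif_counit R[i]) S
       (@dif_homog R[i])) /\
  is_connected (@dif_homog R[i]) /\
  ~ commutative (fun x y : {malg R[i][{fmonom nat}]} => x * y) /\
  ~ cocommutative (@dif_comult R[i]).
Proof.
have [u uE] := unitriangular_solve (fun n => (1%N == n)%:R) (@dif_mx_diag R[i]).
split; last first.
  split; first exact: dif_homog_connected.
  by split; [apply: dif_not_commutative|apply: dif_not_cocommutative].
exists (dif_antipode u); split.
- split; split.
  + exact: dif_comult_linear.
  + exact: dif_comult1.
  + exact: dif_comultM.
  + exact: dif_counit_linear.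
  + exact: dif_counit1.
  + exact: dif_counitM.
  + exact: dif_coassoc.
  + exact: dif_counitl.
  + exact: dif_counitr.
  + exact: dif_antipode_linear.
  + exact: dif_antipodel uE.
  + exact: dif_antipoder uE.
- exact: dif_homog_grading.
- by apply: supportedU; apply: dif_degree1.
- move=> i j x y; apply: supportedM => w w' <- <-; exact: dif_degreeM.
- move=> n x homx; apply: tens_grading_supported.
  by apply: (supported_lin (dif_comult_linear (K := _)) _ homx) => w <-;
    apply: dif_comultU_degree.
- move=> n x n0 homx; apply: (big1_seq (op := +%R)) => w /andP[_ /homx].
  case: w => -[|i s] ew; first by rewrite -ew -fmonom1E dif_degree1 in n0.
  by rewrite big_cons mul0r scaler0.
- by move=> n x; apply: dif_antipode_degree.
Qed.
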